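(* Let $X$ be a real Hilbert space and let $A,B\colon X\rightrightarrows X$ be maximally monotone. Suppose that $A$ is uniformly monotone. Set $T=R_BR_A$. Let $x_0\in X$ and set, for every $n\in\mathbb{N}$, $x_{n+1}=Tx_n$ and $y_n=J_Ax_n$. Then the following hold. (i) Suppose that $\operatorname{zer}(A+B)\neq\varnothing$. Then: (a) $\operatorname{zer}(A+B)$ is a singleton and $\operatorname{Fix}T\neq\varnothing$. (b) There exists $\overline{x}\in\operatorname{Fix}T$ such that $(y_n)_{n\in\mathbb{N}}$ converges strongly to $J_A\overline{x}$ and $\operatorname{zer}(A+B)=\{J_A\overline{x}\}$. If, in addition, $B$ is uniformly monotone, then also: (c) $T$ is strongly nonexpansive. (d) $(x_n)_{n\in\mathbb{N}}$ converges weakly to $\overline{x}$, for some $\overline{x}\in\operatorname{Fix}T$ as in (b). (ii) Suppose that $A^{-1}$ is uniformly monotone. Then: (a) $T$ is a contraction for large distances and there exists $\overline{x}\in X$ such that $\operatorname{Fix}T=\{\overline{x}\}$. (b) $(x_n)_{n\in\mathbb{N}}$ converges strongly to $\overline{x}$.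
   Context: For $A\colon X\rightrightarrows X$, $\operatorname{gra}A=\{(x,x^* )\in X\times X : x^*\in Ax\}$, and $A^{-1}$ is the inverse operator, $x\in A^{-1}x^*\Leftrightarrow x^*\in Ax$. $\operatorname{zer}(A+B)=\{x\in X: 0\in Ax+Bx\}$; $\operatorname{Fix}T=\{x\in X: Tx=x\}$. The resolvent is $J_A=(\mathrm{Id}+A)^{-1}$ and the reflected resolvent is $R_A=2J_A-\mathrm{Id}$; for maximally monotone $A$ these are single-valued and defined on all of $X$. A modulus is an increasing (nondecreasing) function $\phi\colon[0,\infty)\to[0,+\infty]$ that vanishes only at $0$. An operator $A$ is uniformly monotone if there is a modulus $\phi$ such that $\langle x-y,x^*-y^*\rangle\ge\phi(\|x-y\|)$ for all $(x,x^* ),(y,y^* )\in\operatorname{gra}A$. $T\colon X\to X$ is strongly nonexpansive if it is nonexpansive (i.e. $\|Tx-Ty\|\le\|x-y\|$ for all $x,y$) and, for all sequences $(u_n),(v_n)$ in $X$, if $(u_n-v_n)$ is bounded and $\|u_n-v_n\|-\|Tu_n-Tv_n\|\to0$, then $(u_n-v_n)-(Tu_n-Tv_n)\to0$. $T$ is a contraction for large distances if for each $\epsilon>0$ there exists $K_\epsilon<1$ such that $\|Tx-Ty\|\le K_\epsilon\|x-y\|$ whenever $\|x-y\|\ge\epsilon$. *)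

(* Defs.v *)
From HB Require Import structures.
From mathcomp Require Import all_boot all_order all_algebra.
From mathcomp Require Import all_classical all_reals all_analysis.
Set Implicit Arguments.
Unset Strict Implicit.
Unset Printing Implicit Defensive.
Import Order.TTheory GRing.Theory Num.Theory.
Import numFieldNormedType.Exports.
Local Open Scope classical_set_scope.
Local Open Scope ring_scope.

(* A real Hilbert space is a [completeNormedModType R] [X] together with a
   symmetric positive definite bilinear form [ip : {dot X for @idfun R}] that
   induces the norm of [X]. *)
Definition induces_norm (R : realType) (X : completeNormedModType R)
    (ip : {dot X for @idfun R}) : Prop :=
  forall x : X, `|x| = Num.sqrt (ip x x).

Section Operators.
Variables (R : realType) (X : completeNormedModType R).
Variable ip : {dot X for @idfun R}.
Implicit Types (A B : X -> set X) (T : X -> X).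

Definition gra A : set (X * X) := [set p | A p.1 p.2].

Definition op_id : X -> set X := fun x => [set x].

Definition op_add A B : X -> set X :=
  fun x => [set u + v | u in A x & v in B x].

Definition op_inv A : X -> set X := fun u => [set x | A x u].

Definition zer A : set X := [set x | A x 0].

Definition Fix T : set X := [set x | T x = x].

Definition monotone A : Prop :=
  forall x u y v : X, gra A (x, u) -> gra A (y, v) -> 0 <= ip (x - y) (u - v).

Definition maximally_monotone A : Prop :=
  monotone A /\
  forall B, monotone B -> gra A `<=` gra B -> gra B `<=` gra A.

(* [phi] represents a function from [0, +oo[ to [0, +oo]: its values at
   negative arguments are irrelevant. *)
Definition modulus (phi : R -> \bar R) : Prop :=
  [/\ forall t : R, 0 <= t -> (0 <= phi t)%E,
      forall s t : R, 0 <= s -> s <= t -> (phi s <= phi t)%E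
    & forall t : R, 0 <= t -> (phi t = 0%E <-> t = 0)].

Definition uniformly_monotone A : Prop :=
  exists2 phi : R -> \bar R, modulus phi &
    forall x u y v : X, gra A (x, u) -> gra A (y, v) ->
      (phi `|x - y|%R <= (ip (x - y)%R (u - v)%R)%:E)%E.

(* The single-valued selection of (Id + A)^-1, with the junk value 0 where
   (Id + A)^-1 is empty; that does not happen when A is maximally monotone. *)
Definition resolvent A : X -> X :=
  fun_of_rel (fun=> 0) (op_inv (op_add op_id A)).

Definition reflected_resolvent A : X -> X := fun x => 2 *: resolvent A x - x.

Definition nonexpansive T : Prop := forall x y : X, `|T x - T y| <= `|x - y|.

Definition strongly_nonexpansive T : Prop :=
  nonexpansive T /\
  forall u v : nat -> X,
    bounded_fun (fun n => u n - v n) ->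
    (fun n => `|u n - v n| - `|T (u n) - T (v n)|) @ \oo --> (0 : R) ->
    (fun n => (u n - v n) - (T (u n) - T (v n))) @ \oo --> (0 : X).

Definition contraction_for_large_distances T : Prop :=
  forall e : R, 0 < e ->
    exists2 K : R, K < 1 &
      forall x y : X, e <= `|x - y| -> `|T x - T y| <= K * `|x - y|.

Definition weakly_converges (u : nat -> X) (l : X) : Prop :=
  forall y : X, (fun n => ip (u n) y) @ \oo --> ip l y.

End Operators.

(* Main.v *)
Require Import Defs.
From HB Require Import structures.
From mathcomp Require Import all_boot all_order all_algebra.
From mathcomp Require Import all_classical all_reals all_analysis.
From mathcomp Require Import ring lra.
Import Order.TTheory GRing.Theory Num.Theory.
Import numFieldNormedType.Exports.
Local Open Scope classical_set_scope.
Local Open Scope ring_scope.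

(** Put [a = J_A x], [p = R_A x], [b = J_B p], so [T x = x + 2 (b - a)], and let
    [g_A (x, y) = <J_A x - J_A y, (x - J_A x) - (y - J_A y)> >= 0]. Expanding
    squares, [|T x - T y|^2 = |x - y|^2 - 4 g_A (x, y) - 4 g_B (R_A x, R_A y)].
    Taking [x = x_n] and [y] a fixed point, the squared distances to [y] decrease
    by at least [4 g_A (x_n, y)], which therefore tends to 0, and uniform
    monotonicity turns that into convergence of [J_A x_n]. The same identity gives strong nonexpansiveness when [B] is
    uniformly monotone too, hence [x_n - T x_n --> 0], and weak convergence
    follows by comparing asymptotic centres. If [A] and [A^-1] are both
    uniformly monotone, one of [J_A x - J_A y] and its complement has norm at
    least [|x - y| / 2], so [R_A] contracts segments of length in [[e, 2 e]]
    uniformly, hence all longer ones by subdivision; the rest is Rakotch's fixed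
    point theorem.

    Surjectivity of [Id + A] (Minty) and asymptotic centres both come from one
    principle: a strongly convex lower semicontinuous function on a complete
    space has a minimizer, because minimizing sequences are Cauchy. No weak
    compactness is needed. *)

(** * Inner products and minimization *)

Section InnerProduct.
Context {R : realType} {X : completeNormedModType R}.
Context {ip : {dot X for @idfun R}}.
Implicit Types (x y z : X) (a : R).

Lemma ipC x y : ip x y = ip y x.
Proof. by rewrite (hermC ip) expr0 mul1r. Qed.

Lemma ipDl x y z : ip (x + y) z = ip x z + ip y z.
Proof. exact: linearDl. Qed.

Lemma ipDr x y z : ip x (y + z) = ip x y + ip x z.
Proof. exact: linearDr. Qed.

Lemma ipNl x y : ip (- x) y = - ip x y.
Proof. exact: linearNl. Qed.

Lemma ipNr x y : ip x (- y) = - ip x y.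
Proof. exact: linearNr. Qed.

Lemma ipZl a x y : ip (a *: x) y = a * ip x y.
Proof. exact: linearZl_LR. Qed.

Lemma ipZr a x y : ip x (a *: y) = a * ip x y.
Proof. exact: linearZr_LR. Qed.

Lemma ip0l x : ip 0 x = 0.
Proof. exact: linear0l. Qed.

Definition ipE := (ipDl, ipDr, ipNl, ipNr, ipZl, ipZr).

Hypothesis hilbertX : induces_norm ip.

Lemma norm2_ip x : `|x| ^+ 2 = ip x x.
Proof.
rewrite hilbertX sqr_sqrtr//.
have [->|x0] := eqVneq x 0; first by rewrite ip0l.
by rewrite ltW// neq0_dnorm_gt0.
Qed.

Lemma ip_polarization x y : ip x y = (`|x + y| ^+ 2 - `|x - y| ^+ 2) / 4.
Proof. by rewrite !norm2_ip !ipE (ipC y x); field. Qed.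

(** Polarization reduces joint continuity of [ip] to continuity of the norm. *)
Lemma cvg_ip {I : Type} {F : set_system I} {FF : Filter F} (f g : I -> X) x y :
  f @ F --> x -> g @ F --> y -> (fun i => ip (f i) (g i)) @ F --> ip x y.
Proof.
move=> fx gy; have sq (h : I -> X) z : h @ F --> z ->
    (fun i => `|h i| ^+ 2) @ F --> `|z| ^+ 2.
  by move=> hz; rewrite expr2; under eq_fun do rewrite expr2; apply: cvgM;
    apply: cvg_norm.
rewrite ip_polarization; under eq_fun do rewrite ip_polarization.
by apply: cvgMl; apply: cvgB; apply: sq; [exact: cvgD|exact: cvgB].
Qed.

End InnerProduct.

(** A predicate on normed modules, so that minimization applies to [X * X] as well as to [X]. *)
Definition complete_normed {R : realType} (Y : normedModType R) : Prop :=
  forall F : set_system Y, ProperFilter F -> cauchy F -> cvg F.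

(* [P] plays the role of the epigraph of a strongly convex lower
   semicontinuous function. *)
Lemma strongly_convex_min {R : realType} {Y : normedModType R}
    (P : Y -> R -> Prop) (k : R) :
  complete_normed Y -> 0 < k ->
  (exists y r, P y r) ->
  (forall y r, P y r -> 0 <= r) ->
  (forall y r y' r', P y r -> P y' r' ->
     P (2^-1 *: (y + y')) (2^-1 * (r + r') - k * `|y - y'| ^+ 2)) ->
  (forall (u : nat -> Y) (r : nat -> R) y s, (forall n, P (u n) (r n)) ->
     u @ \oo --> y -> r @ \oo --> s -> P y s) ->
  exists y m, P y m /\
    forall y' r', P y' r' -> m + 2 * k * `|y - y'| ^+ 2 <= r'.
Proof.
move=> complY k0 [y0 [r0 P0]] Pge0 Pmid Pclosed.
pose E := [set r | exists y, P y r].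
have hlE : has_lbound E by exists 0 => r [y /Pge0].
have hiE : has_inf E by split=> //; exists r0, y0.
pose m := inf E.
have lem y r : P y r -> m <= r by move=> Pyr; apply: (ge_inf hlE); exists y.
have /choice[w wP] (n : nat) : exists p : Y * R,
    P p.1 p.2 /\ p.2 < m + n.+1%:R^-1.
  have n0 : 0 < n.+1%:R^-1 :> R by rewrite invr_gt0.
  by have [r [y Pyr] rm] := inf_adherent n0 hiE; exists (y, r).
(* A midpoint value is at least the infimum [m], so near-minimizers are close together. Along a
   minimizing sequence this gives the Cauchy property; at the minimizer it gives quadratic growth
   with factor [2 * k]. *)
have gap y r y' r' : P y r -> P y' r' ->
    k * `|y - y'| ^+ 2 <= 2^-1 * (r + r') - m.
  by move=> Py Py'; have := lem _ _ (Pmid _ _ _ _ Py Py'); lra.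
have inv_cvg0 : (fun n : nat => n.+1%:R^-1 : R) @ \oo --> (0 : R).
  exact: cvg_harmonic.
have rm : (fun n => (w n).2) @ \oo --> m.
  apply: (@squeeze_cvgr _ _ _ _ (fun=> m) (fun n : nat => m + n.+1%:R^-1)).
  - apply: nearW => n /=; have [Pn lt] := wP n.
    by rewrite (lem _ _ Pn) ltW.
  - exact: cvg_cst.
  - by rewrite -[X in _ --> X]addr0; apply: cvgD => //; exact: cvg_cst.
have : cvg ((fun n => (w n).1) @ \oo).
  apply: complY; apply: cauchy_exP => e e0.
  have ke : 0 < k * e ^+ 2 by rewrite mulr_gt0 ?exprn_gt0.
  have [N _ HN] := cvgr_lt _ inv_cvg0 _ ke.
  exists (w N).1; exists N => // n /= Nn.
  rewrite -ball_normE /ball_ /=.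
  rewrite -(ltr_pXn2r (n := 2)) ?nnegrE ?(ltW e0)// -(ltr_pM2l k0).
  have [PN ltN] := wP N; have [Pn ltn] := wP n.
  have := gap _ _ _ _ PN Pn; have := HN _ (leqnn N); have := HN _ Nn.
  move: ltN ltn; rewrite /=; move: (N.+1%:R^-1) (n.+1%:R^-1) => a b; lra.
move=> /cvg_ex[y yP].
have Py : P y m by apply: (Pclosed _ _ _ _ _ yP rm) => n; have [] := wP n.
exists y, m; split=> // y' r' Py'; have := gap _ _ _ _ Py Py'; lra.
Qed.

(** * Minty's theorem *)

Lemma complete_normed_id {R : realType} (X : completeNormedModType R) :
  complete_normed X.
Proof. by move=> F FF /cauchy_cvg. Qed.

Lemma complete_normed_prod {R : realType} (X Y : normedModType R) :
  complete_normed X -> complete_normed Y -> complete_normed (X * Y)%type.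
Proof.
move=> complX complY F FF /cauchyP Fc.
have /cvg_ex[a Fa] : cvg (fst @ F).
  apply: complX; apply/cauchyP => e /Fc[[a b] Fab]; exists a.
  by apply: (@filterS _ F _ _ _ _ Fab) => p [].

have /cvg_ex[b Fb] : cvg (snd @ F).
  apply: complY; apply/cauchyP => e /Fc[[a' b] Fab]; exists b.
  by apply: (@filterS _ F _ _ _ _ Fab) => p [].

apply/cvg_ex; exists (a, b).
move=> S /(cvg_pair Fa Fb) FS.
by apply: (@filterS _ F _ _ _ _ FS) => -[].
Qed.

Lemma ler_of_shrink {R : realFieldType} (d s : R) : 0 <= d ->
  (forall t, 0 < t -> t <= 1 -> (1 - t) * d <= s) -> d <= s.
Proof.
move=> d0 ds; have s0 : 0 <= s by have := ds 1 ltr01 (lexx 1); lra.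
rewrite leNgt; apply/negP => sd.
have d1 : 0 < 2 * d by lra.
(* With this [t], [(1 - t) * d] is the mean of [d] and [s], which exceeds [s]. *)
pose t := (d - s) / (2 * d).
have tE : t * (2 * d) = d - s by rewrite divfK// gt_eqF.
have t0 : 0 < t by rewrite divr_gt0 ?subr_gt0.
have t1 : t <= 1 by rewrite ler_pdivrMr//; lra.
by have := ds t t0 t1; lra.
Qed.

Section Minty.
Context {R : realType} {X : completeNormedModType R}.
Context {ip : {dot X for @idfun R}}.
Hypothesis hilbertX : induces_norm ip.
Implicit Types A : X -> set X.

(** Adjoining [(x, u)] keeps the graph monotone, so by maximality the pair was already there. *)
Lemma maximally_monotone_mem {A x u} : maximally_monotone ip A ->
  (forall a b, A a b -> 0 <= ip (x - a) (u - b)) -> A x u.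
Proof.
move=> [monoA maxA] xu.
pose A' := fun y => [set v | A y v \/ (y = x /\ v = u)].
suff monoA' : Defs.monotone ip A'.
  by apply: (maxA A' monoA' _ (x, u)); [move=> p; left | right].
have ipNN (a b : X) c d : ip (a - b) (c - d) = ip (b - a) (d - c).
  by rewrite !ipE; ring.
move=> a b c d [Aab|[/= -> ->]] [Acd|[/= -> ->]].
- exact: monoA.
- by rewrite ipNN; exact: xu.
- exact: xu.
- by rewrite subrr ip0l.
Qed.

Lemma maximally_monotone_nonempty {A} : maximally_monotone ip A ->
  exists a b, A a b.
Proof.
move=> maxA; apply: contrapT => /forallNP A0.
have AF a b : ~ A a b by move=> Aab; apply: (A0 a); exists b.
apply: (AF 0 0); apply: (maximally_monotone_mem maxA) => a b Aab.
by have := AF _ _ Aab.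
Qed.

(* Minimizing the Fitzpatrick function plus half the squared norm of [X * X]
   yields [(x, u)]; optimality puts [(- u, - x)] in the graph and forces
   [u = - x]. *)
Lemma minty0 A : maximally_monotone ip A -> exists x, A x (- x).
Proof.
move=> maxA; have [monoA _] := maxA.
pose q a b (p : X * X) := ip p.1 b + ip a p.2 - ip a b +
  2^-1 * (`|p.1| ^+ 2 + `|p.2| ^+ 2).
pose P p (r : R) := forall a b, A a b -> q a b p <= r.
pose D (p p' : X * X) := `|p.1 - p'.1| ^+ 2 + `|p.2 - p'.2| ^+ 2.
have qconv a b p p' t :
    q a b ((1 - t) *: p + t *: p') =
    (1 - t) * q a b p + t * q a b p' - 2^-1 * t * (1 - t) * D p p'.
  rewrite /q /D; case: p p' => [x u] [x' u'] /=.
  by rewrite !(norm2_ip hilbertX) !ipE (ipC x' x) (ipC u' u); field.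
have Pconv : forall p r p' r' t, P p r -> P p' r' -> 0 <= t -> t <= 1 ->
    P ((1 - t) *: p + t *: p')
      ((1 - t) * r + t * r' - 2^-1 * t * (1 - t) * D p p').
  move=> p r p' r' t Pp Pp' t0 t1 a b Aab; rewrite qconv lerB// lerD//.
    by rewrite ler_wpM2l ?subr_ge0//; exact: Pp.
  by rewrite ler_wpM2l//; exact: Pp'.
have Pgraph a b : A a b -> P (a, b) (ip a b + 2^-1 * (`|a| ^+ 2 + `|b| ^+ 2)).
  move=> Aab a' b' Aab'; rewrite /q/= lerD2r.
  by have := monoA _ _ _ _ Aab Aab'; rewrite !ipE; lra.
(* The Fitzpatrick function dominates the pairing: otherwise [p] would be monotonically related to
   the whole graph, hence lie in it, and [q] with [a], [b] taken from [p] itself would contradict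
   [lt]. *)
have Pge p r : P p r -> ip p.1 p.2 + 2^-1 * (`|p.1| ^+ 2 + `|p.2| ^+ 2) <= r.
  move=> Pp; rewrite leNgt; apply/negP => lt.
  have Ap : A p.1 p.2.
    apply: (maximally_monotone_mem maxA) => a b Aab.
    by have := Pp _ _ Aab; rewrite /q !ipE; lra.
  by have := Pp _ _ Ap; rewrite /q; lra.
have sq_ipD x u : `|x + u| ^+ 2 = `|x| ^+ 2 + `|u| ^+ 2 + 2 * ip x u.
  by rewrite !(norm2_ip hilbertX) !ipE (ipC u x); ring.
(* [8^-1] is the gain [2^-1 * t * (1 - t)] at [t = 2^-1]; [D] dominates the square of the product
   norm, which is a maximum. *)
have [[x u] [m [Pm minm]]] : exists p m, P p m /\
    forall p' r', P p' r' -> m + 2 * 8^-1 * `|p - p'| ^+ 2 <= r'.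
  apply: strongly_convex_min => //.
  - by apply: complete_normed_prod; exact: complete_normed_id.
  - have [a [b Aab]] := maximally_monotone_nonempty maxA.
    by exists (a, b); eexists; exact: Pgraph Aab.
  - move=> [x u] r /Pge /=; have := sq_ipD x u; have := sqr_ge0 `|x + u|; lra.
  - move=> p r p' r' Pp Pp' a b Aab.
    have h0 : 0 <= 2^-1 :> R by lra.
    have h1 : 2^-1 <= 1 :> R by lra.
    have := Pconv _ _ _ _ _ Pp Pp' h0 h1 _ _ Aab.
    have -> : (1 - 2^-1 : R) = 2^-1 by lra.
    rewrite -scalerDr => /le_trans; apply.
    have : `|p - p'| ^+ 2 <= D p p'; last lra.
    rewrite prod_normE /D /=.
    have := sqr_ge0 `|p.1 - p'.1|; have := sqr_ge0 `|p.2 - p'.2|.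
    by case: (leP `|p.1 - p'.1| `|p.2 - p'.2|) => _; lra.
  - move=> v r p s Pv vp rs a b Aab.
    apply: (@ler_cvg_to _ _ _ _ (fun n => q a b (v n)) _ _ _ _ rs);
      last by apply: nearW => n; exact: Pv.
    have v1 : (fun n => (v n).1) @ \oo --> p.1.
      exact: (cvg_comp _ _ vp cvg_fst).
    have v2 : (fun n => (v n).2) @ \oo --> p.2.
      exact: (cvg_comp _ _ vp cvg_snd).
    have cst (c : X) : (fun=> c : X) @ \oo --> c by exact: cvg_cst.
    rewrite /q !(norm2_ip hilbertX).
    under eq_fun do rewrite !(norm2_ip hilbertX).
    apply: cvgD; last by apply: cvgMr; apply: cvgD; exact: (cvg_ip hilbertX).
    apply: cvgB; last exact: cvg_cst.
    by apply: cvgD; exact: (cvg_ip hilbertX).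
have {}minm p r : P p r -> m <= r.
  by move=> /minm; apply: le_trans; rewrite lerDl mulr_ge0 ?sqr_ge0.
(* [D/2] is the sharp strong convexity gain, reached as [t --> 0]. *)
have opt a b : A a b ->
    m + 2^-1 * D (x, u) (a, b) <= ip a b + 2^-1 * (`|a| ^+ 2 + `|b| ^+ 2).
  move=> /Pgraph Pr; rewrite -lerBrDl; apply: ler_of_shrink => [|t t0 t1].
    by rewrite mulr_ge0// addr_ge0// sqr_ge0.
  have := minm _ _ (Pconv _ _ _ _ _ Pm Pr (ltW t0) t1).
  move: (D _ _) (ip a b + _) => d r h.
  by rewrite -(ler_pM2l t0); lra.
(* Adding [opt] to [Pge] at the minimizer cancels [m] and the squares of [a] and [b]; what remains
   completes to [|x + u| ^+ 2]. *)
have key a b : A a b -> `|x + u| ^+ 2 <= ip (- u - a) (- x - b).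
  move=> /opt; have := Pge _ _ Pm; rewrite /D /= !(norm2_ip hilbertX) !ipE.
  rewrite (ipC u x) (ipC a x) (ipC b u); lra.
have Aux : A (- u) (- x).
  apply: (maximally_monotone_mem maxA) => a b /key.
  exact: le_trans (sqr_ge0 _).
have := key _ _ Aux; rewrite subrr ip0l => xu0.
have /eqP : `|x + u| = 0 by apply/eqP; rewrite -sqrf_eq0 eq_le xu0 sqr_ge0.
rewrite normr_eq0 addr_eq0 => /eqP xE; exists (- u).
by rewrite -{2}xE.
Qed.

End Minty.

(** * Weak convergence of Fejer monotone orbits *)

(** One-sided uniform continuity of squaring on [[0, M]]: for [d <= 1], [(s + d) ^+ 2] exceeds
    [s ^+ 2] by at most [d * (2 * M + 1)]. *)
Lemma sqr_perturb {R : realFieldType} {M e : R} : 0 <= M -> 0 < e ->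
  exists2 d, 0 < d & forall s t, 0 <= s -> s <= M -> 0 <= t -> t <= s + d ->
    t ^+ 2 <= s ^+ 2 + e.
Proof.
move=> M0 e0; have M1 : 0 < 2 * M + 1 by lra.
pose d := Num.min 1 (e / (2 * M + 1)).
have d0 : 0 < d by rewrite lt_min ltr01 divr_gt0.
have d1 : d <= 1 by rewrite ge_min lexx.
have de : d * (2 * M + 1) <= e by rewrite -ler_pdivlMr// ge_min lexx orbT.
exists d => // s t s0 sM t0 ts.
have tt : t ^+ 2 <= (s + d) ^+ 2 by rewrite lerXn2r// nnegrE; lra.
apply: (le_trans tt).
have sd : s * d <= M * d by rewrite ler_wpM2r// ltW.
have dd : d * d <= d by rewrite ger_pMl.
by rewrite sqrrD; lra.
Qed.

Lemma sqr_norm_le0 {R : realType} {V : normedModType R} (v : V) :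
  `|v| ^+ 2 <= 0 -> v = 0.
Proof.
move=> v0; apply/eqP; rewrite -normr_eq0 -sqrf_eq0; apply/eqP/le_anti.
by rewrite v0 sqr_ge0.
Qed.

Section WeakConvergence.
Context {R : realType} {X : completeNormedModType R}.
Context {ip : {dot X for @idfun R}}.
Hypothesis hilbertX : induces_norm ip.

(** The epigraph, in [(c, r)], of the limit superior of the squared distances along [F]; its
    minimizer is the asymptotic centre. *)
Definition limsup_sqr_dist_le {I : Type} (F : set_system I) (x : I -> X) (c : X)
    (r : R) : Prop :=
  forall e, 0 < e -> \forall i \near F, `|x i - c| ^+ 2 <= r + e.

Lemma asymptotic_center {I : Type} {F : set_system I} {FF : ProperFilter F}
    {x : I -> X} {M : R} : (forall i, `|x i| <= M) ->
  exists c m, limsup_sqr_dist_le F x c m /\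
    forall c' r, limsup_sqr_dist_le F x c' r -> m + 2^-1 * `|c - c'| ^+ 2 <= r.
Proof.
move=> xM; have -> : 2^-1 = 2 * 4^-1 :> R by field.
apply: strongly_convex_min => //.
- exact: complete_normed_id.
- exists 0, (M ^+ 2) => e e0; apply: nearW => i; rewrite subr0.
  have M0 := le_trans (normr_ge0 _) (xM i).
  by apply: ler_wpDr; [exact: ltW|rewrite lerXn2r ?nnegrE].
- move=> c r Pcr; apply/ler_addgt0Pr => e e0.
  have [i] := filter_ex (Pcr _ e0); exact/le_trans/sqr_ge0.
- move=> c r c' r' Pc Pc' e e0.
  have := Pc _ e0; have := Pc' _ e0; apply: filterS2 => i.
  have -> : `|x i - 2^-1 *: (c + c')| ^+ 2 = 2^-1 * (`|x i - c| ^+ 2 +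
      `|x i - c'| ^+ 2) - 4^-1 * `|c - c'| ^+ 2.
    rewrite !(norm2_ip hilbertX) !ipE (ipC c (x i)) (ipC c' (x i)) (ipC c' c).
    by field.
  by lra.
- move=> u r c s Pu /cvgrPdist_le uc /cvgrPdist_le rs e e0.
  have e2 : 0 < e / 2 by rewrite divr_gt0.
  have M0 : 0 <= M + `|c| + 1.
    have [i _] := filter_ex (@filterT _ F _).
    by rewrite !addr_ge0// (le_trans _ (xM i)).
  have [d d0 Hd] := sqr_perturb M0 e2.
  have e4 : 0 < e / 4 by rewrite divr_gt0.
  (* Of the slack [e], one half pays for replacing [u N] by [c], one quarter for replacing [r N] by
     [s], and one quarter is spent in [Pu N]. *)
  have [N] : exists N,
      [/\ `|c - u N| <= d, `|c - u N| <= 1 & `|s - r N| <= e / 4].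
    apply: (@filter_ex _ \oo).
    by apply: filterS3 (uc _ d0) (uc _ ltr01) (rs _ e4) => n; split.
  move=> [cd c1]; rewrite ler_distl => /andP[rN _].
  have := Pu N _ e4; apply: filterS => i iN.
  have uN : `|u N| <= `|c| + 1.
    rewrite -(subrK c (u N)) addrC.
    by rewrite (le_trans (ler_normD _ _))// lerD2l distrC.
  have sM : `|x i - u N| <= M + `|c| + 1.
    by rewrite -addrA (le_trans (ler_normB _ _))// lerD.
  have td : `|x i - c| <= `|x i - u N| + d.
    by rewrite (le_trans (ler_distD (u N) _ _))// lerD2l distrC.
  have := Hd _ _ (normr_ge0 _) sM (normr_ge0 _) td; lra.
Qed.

(* The asymptotic centre of the sequence along any proper filter finer than
   [\oo] is a fixed point; monotonicity of the distances to fixed points makes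
   all these centres equal, which replaces weak sequential compactness. *)
Lemma fejer_weak_cvg {T : X -> X} {x : nat -> X} :
  nonexpansive T -> Fix T !=set0 ->
  (forall p, Fix T p -> nonincreasing_seq (fun n => `|x n - p|)) ->
  (fun n => x n - T (x n)) @ \oo --> (0 : X) ->
  exists2 c, Fix T c & weakly_converges ip x c.
Proof.
move=> neT [p Tp] fej /cvgrPdist_le xT.
have xM n : `|x n| <= `|x 0%N - p| + `|p|.
  by rewrite -{1}(subrK p (x n)) (le_trans (ler_normD _ _))// lerD2r fej.
have centerT F c m : ProperFilter F -> F --> \oo ->
    limsup_sqr_dist_le F x c m ->
    (forall c' r, limsup_sqr_dist_le F x c' r ->
       m + 2^-1 * `|c - c'| ^+ 2 <= r) -> Fix T c.
  move=> FF Foo Pc minc.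
  (* As [x n - T (x n)] vanishes and [T] is nonexpansive, [T c] is as good a centre as [c];
     quadratic growth then identifies the two. *)
  have : limsup_sqr_dist_le F x (T c) m.
    move=> e e0; have e2 : 0 < e / 2 by rewrite divr_gt0.
    have M0 : 0 <= `|x 0%N - p| + `|p| + `|c| by rewrite !addr_ge0.
    have [d d0 Hd] := sqr_perturb M0 e2.
    have := Foo _ (xT _ d0); have := Pc _ e2.
    apply: filterS2 => n ne; rewrite sub0r normrN => nd.
    have sM : `|x n - c| <= `|x 0%N - p| + `|p| + `|c|.
      by rewrite (le_trans (ler_normB _ _))// lerD2r.
    have td : `|x n - T c| <= `|x n - c| + d.
      by rewrite (le_trans (ler_distD (T (x n)) _ _))// addrC lerD.
    have := Hd _ _ (normr_ge0 _) sM (normr_ge0 _) td; lra.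
  move=> /minc h; rewrite /Fix /=.
  have /sqr_norm_le0/subr0_eq // : `|c - T c| ^+ 2 <= 0 by lra.
have oo_id : (\oo : set_system nat) --> \oo by [].
have [c [m [Pc minc]]] := @asymptotic_center _ \oo _ _ _ xM.
have Tc : Fix T c by exact: centerT oo_id Pc minc.
have half d e : 0 < e -> \forall n \near \oo, ip (x n - c) d < e.
  move=> e0; apply: contrapT => Nnear.
  (* If the estimate fails, the bad indices meet every neighbourhood of [\oo], so the trace of [\oo]
     on them is a proper filter with its own centre. *)
  pose F := within [set n | e <= ip (x n - c) d] \oo.
  have FF : ProperFilter F.
    apply: Build_ProperFilter_ex => A FA; apply: contrapT => /forallNP A0.
    have {}FA : \forall n \near \oo, e <= ip (x n - c) d -> A n := FA.
    apply: Nnear; apply: filterS FA => n nA; rewrite ltNge; apply/negP => /nA.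
    exact: A0.
  have Foo : F --> \oo by exact: cvg_within.
  have [c' [m' [Pc' minc']]] := @asymptotic_center _ F _ _ _ xM.
  have Tc' : Fix T c' by exact: centerT Foo Pc' minc'.
  have PFc : limsup_sqr_dist_le F x c m by move=> s s0; exact/Foo/Pc.
  (* Since [c'] is a fixed point, the distances to it decrease, and a bound at one index persists at
     all later ones. *)
  have Poo : limsup_sqr_dist_le \oo x c' m'.
    move=> s s0; have [i xi] := filter_ex (Pc' _ s0).
    exists i => // n /= ni; apply: le_trans xi.
    by rewrite lerXn2r ?nnegrE// fej.
  have h1 := minc _ _ Poo; have h2 := minc' _ _ PFc.
  have := sqr_ge0 `|c - c'|; rewrite [`|c' - c|]distrC in h2 => cc'.
  have /sqr_norm_le0/subr0_eq c'E : `|c - c'| ^+ 2 <= 0 by lra.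
  have {h1 h2}mm' : m = m' by lra.
  rewrite -{}c'E -{}mm' {Pc' Tc' Poo cc' c' m'} in minc'.
  (* Along [F], moving the centre from [c] to [c + t *: d] lowers the bound to [m - t * e - t ^+ 2],
     below the minimum [m]. *)
  pose t := e / (`|d| ^+ 2 + 1).
  have d1 : 0 < `|d| ^+ 2 + 1 by rewrite ltr_wpDl ?sqr_ge0.
  have t0 : 0 < t by rewrite divr_gt0.
  have tE : t * (`|d| ^+ 2 + 1) = e by rewrite divfK// gt_eqF.
  have /minc' : limsup_sqr_dist_le F x (c + t *: d)
      (m - 2 * (t * e) + t * (t * `|d| ^+ 2)).
    move=> s s0; apply: filterS2 (PFc _ s0) (withinT _ _) => n ns /= en.
    have -> : `|x n - (c + t *: d)| ^+ 2 =
        `|x n - c| ^+ 2 - 2 * (t * ip (x n - c) d) + t * (t * `|d| ^+ 2).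
      rewrite !(norm2_ip hilbertX) !ipE (ipC c (x n)) (ipC d (x n)) (ipC d c).
      by ring.
    by have := ler_wpM2l (ltW t0) en; lra.
  have := sqr_ge0 `|c - (c + t *: d)|.
  have : t * (t * `|d| ^+ 2) = t * (e - t) by rewrite -tE; ring.
  have := mulr_gt0 t0 e0; have := mulr_gt0 t0 t0; lra.
exists c => // y; apply/cvgrPdist_lt => e e0.
have := half y e e0; have := half (- y) e e0; apply: filterS2 => n.
by rewrite distrC ltr_distl !ipE => h1 h2; apply/andP; split; lra.
Qed.

End WeakConvergence.

(** * Contractions for large distances *)

Section Rakotch.
Context {R : realType} {X : completeNormedModType R} {T : X -> X}.

Lemma contraction_nonneg_factor : contraction_for_large_distances T ->
  forall e, 0 < e -> exists K, [/\ 0 <= K, K < 1 &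
    forall x y, e <= `|x - y| -> `|T x - T y| <= K * `|x - y|].
Proof.
move=> cT e /cT[K K1 TK]; exists (Num.max K 0); split.
- by rewrite le_max lexx orbT.
- by rewrite gt_max K1 ltr01.
- move=> x y /TK /le_trans; apply.
  by rewrite ler_wpM2r// le_max lexx.
Qed.

(** The step lengths [d n] decrease to some [l]; if [l > 0], the factor [K] at scale [l] would give
    [l <= K * l]. Small steps then trap the orbit near [x N]. *)
Lemma rakotch {x : nat -> X} : nonexpansive T ->
  contraction_for_large_distances T -> (forall n, x n.+1 = T (x n)) ->
  exists c, Fix T = [set c] /\ x @ \oo --> c.
Proof.
move=> neT /contraction_nonneg_factor cT xS.
pose d n := `|x n - x n.+1|.
have d_noninc : nonincreasing_seq d.
  by apply/nonincreasing_seqP => n; rewrite /d !xS.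
have /cvg_ex[l dl] : cvgn d.
  apply: (nonincreasing_is_cvgn d_noninc).
  by exists 0 => _ [n _ <-]; exact: normr_ge0.
have l0 : 0 <= l by apply: (cvgr_to_ge dl); apply: nearW => n; exact: normr_ge0.
have d0 : d @ \oo --> (0 : R).
  suff -> : 0 = l by [].
  apply/eqP; rewrite eq_sym eq_le l0 andbT leNgt; apply/negP => lgt0.
  have [K [K0 K1 TK]] := cT _ lgt0.
  have dS : (fun n => d n.+1) @ \oo --> l by rewrite cvg_shiftS.
  have Kd : (fun n => K * d n) @ \oo --> K * l by exact: cvgMr.
  have : l <= K * l.
    apply: (ler_cvg_to dS Kd); apply: nearW => n.
    have := TK (x n) (x n.+1); rewrite -!xS; apply.
    apply: (cvgr_to_le dl); exists n => // m /= nm; exact: d_noninc.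
  have := mulr_gt0 lgt0 (_ : 0 < 1 - K); rewrite subr_gt0 => /(_ K1).
  by rewrite mulrBr mulr1 mulrC; lra.
have : cvgn x.
  apply: cauchy_cvg; apply: cauchy_exP => e e0.
  have e3 : 0 < e / 3 by rewrite divr_gt0.
  have [K [K0 K1 TK]] := cT _ e3.
  have eta0 : 0 < (1 - K) * (e / 3) by rewrite mulr_gt0// subr_gt0.
  have [N _ HN] := cvgr_lt _ d0 _ eta0.
  have {HN} dN := HN _ (leqnn N).
  (* A far point has its distance shrunk to at most [K * (2 * (e / 3))], a near one stays within
     [e / 3]; adding [d N < (1 - K) * (e / 3)] stays below [2 * (e / 3)] in both cases. *)
  have trap k : `|x N - x (N + k)%N| <= 2 * (e / 3).
    elim: k => [|k IH]; first by rewrite addn0 subrr normr0; lra.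
    have step : `|x N - x (N + k.+1)%N| <= d N + `|T (x N) - T (x (N + k)%N)|.
      by rewrite addnS /d xS -(xS N) ler_distD.
    have Ke : 0 <= K * (e / 3) by rewrite mulr_ge0// ltW.
    have [far|near] := leP (e / 3) `|x N - x (N + k)%N|.
      have := TK _ _ far; have := ler_wpM2l K0 IH.
      by move: dN; rewrite /=; lra.
    by have := neT (x N) (x (N + k)%N); move: dN; rewrite /=; lra.
  exists (x N), N => // n /= Nn.
  rewrite -ball_normE /ball_ /= -(subnKC Nn).
  by apply: le_lt_trans (trap _) _; lra.
move=> /cvg_ex[c xc].
have Tc : T c = c.
  apply: (@cvg_unique _ (@norm_hausdorff _ _) ((fun n => x n.+1) @ \oo)).
    rewrite (_ : (fun n => x n.+1) = T \o x); last exact/funext/xS.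
    apply/cvgrPdist_le => e e0; move/cvgrPdist_le : xc => /(_ _ e0).
    by apply: filterS => n; apply: le_trans; exact: neT.
  by rewrite /= cvg_shiftS.
exists c; split=> //; apply/seteqP; split=> [c' Tc'|_ ->//].
apply/eqP; rewrite -subr_eq0 -normr_le0 leNgt; apply/negP => cc'.
have [K [K0 K1 TK]] := cT _ cc'.
have := TK _ _ (lexx _); rewrite Tc Tc'.
have := mulr_gt0 cc' (_ : 0 < 1 - K); rewrite subr_gt0 => /(_ K1).
by rewrite mulrBr mulr1 mulrC; lra.
Qed.

(* Halving a long segment reduces it to segments of length in [e, 2 e]. *)
Lemma contraction_of_local (ne : nonexpansive T) :
  (forall e, 0 < e -> exists2 K, K < 1 & forall x y,
     e <= `|x - y| -> `|x - y| <= 2 * e -> `|T x - T y| <= K * `|x - y|) ->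
  contraction_for_large_distances T.
Proof.
move=> loc e e0; have [K K1 TK] := loc _ e0; exists K => // x y.
have [k] : exists k : nat, `|x - y| <= 2 ^+ k * e.
  exists (Num.bound (`|x - y| / e)); rewrite -ler_pdivrMr//.
  apply: ltW; apply: lt_le_trans (archi_boundP _) _.
    by rewrite divr_ge0// ltW.
  by rewrite -natrX ler_nat ltnW// ltn_expl.
elim: k x y => [|k IH] x y.
  by rewrite mul1r => h1 h2; apply: TK => //; lra.
move=> xyk exy; have [le2|gt2] := leP `|x - y| (2 * e); first exact: TK.
pose z := 2^-1 *: (x + y).
have half : 2^-1 + 2^-1 = 1 :> R by lra.
have dbl (v : X) : v = 2^-1 *: v + 2^-1 *: v by rewrite -scalerDl half scale1r.
have xz : `|x - z| = 2^-1 * `|x - y|.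
  rewrite -[X in _ = X * _]ger0_norm// -normrZ scalerBr /z scalerDr.
  by rewrite {1}(dbl x) addrKA.
have zy : `|z - y| = 2^-1 * `|x - y|.
  rewrite -[X in _ = X * _]ger0_norm// -normrZ scalerBr /z scalerDr.
  by rewrite {2}(dbl y) addrKA.
rewrite exprS in xyk.
have hx : `|T x - T z| <= K * (2^-1 * `|x - y|).
  by rewrite -xz; apply: IH; rewrite xz; lra.
have hy : `|T z - T y| <= K * (2^-1 * `|x - y|).
  by rewrite -zy; apply: IH; rewrite zy; lra.
by have := ler_distD (T z) (T x) (T y); lra.
Qed.

End Rakotch.

(** * Resolvents *)

Section MonotoneOperators.
Context {R : realType} {X : completeNormedModType R}.
Context {ip : {dot X for @idfun R}}.
Hypothesis hilbertX : induces_norm ip.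
Implicit Types A B : X -> set X.

(** Translating the values of [A] by [- w] preserves maximal monotonicity and reduces to
    [minty0]. *)
Lemma minty {A} : maximally_monotone ip A -> forall w, exists x, A x (w - x).
Proof.
move=> [monoA maxA] w; pose A' x := [set u | A x (u + w)].
have shift (u v c : X) : (u + c) - (v + c) = u - v.
  by rewrite opprD addrACA subrr addr0.
suff /(minty0 hilbertX)[x] : maximally_monotone ip A'.
  by rewrite /A' /= addrC; exists x.
split=> [x u y v Au Av|B monoB AB [x u] /= Bxu].
  by have := monoA x (u + w) y (v + w) Au Av; rewrite shift.
pose B' y := [set v | B y (v - w)].
apply: (maxA B' _ _ (x, u + w)).
- move=> a b c d Bb Bd; have := monoB a (b - w) c (d - w) Bb Bd.
  by rewrite shift.
- by move=> [a b] /= Aab; apply: (AB (a, b - w)); rewrite /gra/= /A'/= subrK.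
- by rewrite /gra/= /B'/= addrK.
Qed.

(** Minty's theorem makes the defining relation nonempty at [w], so the default value [0] is never
    the reason for the output. *)
Lemma resolventP {A} : maximally_monotone ip A ->
  forall w, A (resolvent A w) (w - resolvent A w).
Proof.
move=> maxA w; have [x Ax] := minty maxA w.
have [|_ -> [v Av vE]] :=
  @fun_of_relP _ _ (op_inv (op_add (@op_id R X) A)) (fun=> 0) w.
  by exists x, x => //; exists (w - x); rewrite // addrC subrK.
by rewrite /resolvent -{2}vE addrC addKr.
Qed.

Lemma resolvent_eq {A} : maximally_monotone ip A ->
  forall a w, A a (w - a) -> resolvent A w = a.
Proof.
move=> maxA a w Aa; have [monoA _] := maxA.
have := monoA _ _ _ _ (resolventP maxA w) Aa.
set b := resolvent A w => h; apply/subr0_eq/sqr_norm_le0.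
by move: h; rewrite (norm2_ip hilbertX) !ipE; lra.
Qed.

Definition resolvent_gap A x y := ip (resolvent A x - resolvent A y)
  ((x - resolvent A x) - (y - resolvent A y)).

Lemma resolvent_gap_ge0 {A} : maximally_monotone ip A ->
  forall x y, 0 <= resolvent_gap A x y.
Proof.
move=> maxA x y; have [monoA _] := maxA.
exact: monoA (resolventP maxA x) (resolventP maxA y).
Qed.

Lemma reflected_resolvent_sqr_dist A x y :
  `|reflected_resolvent A x - reflected_resolvent A y| ^+ 2 =
  `|x - y| ^+ 2 - 4 * resolvent_gap A x y.
Proof.
rewrite /resolvent_gap /reflected_resolvent.
move: (resolvent A x) (resolvent A y) => a b.
rewrite !(norm2_ip hilbertX) !ipE (ipC x a) (ipC y a) (ipC x b) (ipC y b).
by rewrite (ipC b a) (ipC y x); ring.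
Qed.

(* The only information ever used from a modulus is positivity at each
   [e > 0]; this also absorbs the value [+oo]. *)
Lemma uniformly_monotone_gap {A} : uniformly_monotone ip A ->
  forall e, 0 < e -> exists2 d, 0 < d & forall x u y v, A x u -> A y v ->
    e <= `|x - y| -> d <= ip (x - y) (u - v).
Proof.
move=> [phi [phi0 phi_mono phi_eq0] unifA] e e0.
have pe : (0 < phi e)%E.
  rewrite lt_neqAle phi0 ?ltW// andbT; apply/eqP => /esym.
  by move/(phi_eq0 _ (ltW e0)) => e_eq0; rewrite e_eq0 ltxx in e0.
have [d d0 dphi] : exists2 d : R, 0 < d & (d%:E <= phi e)%E.
  case: (phi e) pe => [r r0| _ |//]; first by exists r.
  by exists 1; rewrite ?leey.
exists d => // x u y v Axu Ayv exy; rewrite -lee_fin.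
apply: le_trans dphi (le_trans _ (unifA _ _ _ _ Axu Ayv)).
by apply: phi_mono => //; exact: ltW.
Qed.

Lemma resolvent_gap_cvg {A} {I : Type} {F : set_system I} {FF : Filter F}
    {u v : I -> X} : maximally_monotone ip A -> uniformly_monotone ip A ->
  (fun i => resolvent_gap A (u i) (v i)) @ F --> (0 : R) ->
  (fun i => resolvent A (u i) - resolvent A (v i)) @ F --> (0 : X).
Proof.
move=> maxA unifA /cvgrPdist_lt gap0.
apply/cvgrPdist_lt => e e0.
have [d d0 Hd] := uniformly_monotone_gap unifA e e0.
have := gap0 _ d0; apply: filterS => i; rewrite !sub0r !normrN.
rewrite ger0_norm ?resolvent_gap_ge0// => lt_d.
rewrite ltNge; apply/negP => le_e.
have := Hd _ _ _ _ (resolventP maxA (u i)) (resolventP maxA (v i)) le_e.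
by move=> /le_lt_trans/(_ lt_d); rewrite ltxx.
Qed.

Lemma reflected_resolvent_nonexpansive {A} : maximally_monotone ip A ->
  nonexpansive (reflected_resolvent A).
Proof.
move=> maxA x y; rewrite -(@ler_pXn2r _ 2) ?nnegrE//.
rewrite reflected_resolvent_sqr_dist.
by rewrite lerBlDr lerDl mulr_ge0// resolvent_gap_ge0.
Qed.

(** Uniform monotonicity supplies only an absolute gap [d]; the upper bound [2 * e] on the length
    turns it into a relative factor. *)
Lemma reflected_resolvent_local_contraction {A} : maximally_monotone ip A ->
  uniformly_monotone ip A -> uniformly_monotone ip (op_inv A) ->
  forall e, 0 < e -> exists2 K, K < 1 & forall x y,
    e <= `|x - y| -> `|x - y| <= 2 * e ->
    `|reflected_resolvent A x - reflected_resolvent A y| <= K * `|x - y|.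
Proof.
move=> maxA unifA unifV e e0.
have e2 : 0 < e / 2 by rewrite divr_gt0.
have [d1 d1_gt0 gapA] := uniformly_monotone_gap unifA _ e2.
have [d2 d2_gt0 gapV] := uniformly_monotone_gap unifV _ e2.
pose d := Num.min d1 d2; have d0 : 0 < d by rewrite lt_min d1_gt0.
(* Chosen so that [s <= 2 * e] gives [k * s ^+ 2 <= 2 * d], whence [s ^+ 2 - 4 * d] is at most
   [(1 - 2 * k) * s ^+ 2], and so at most [((1 - k) * s) ^+ 2]. *)
pose k := d / (2 * e ^+ 2).
have ee0 : 0 < 2 * e ^+ 2 by rewrite mulr_gt0 ?exprn_gt0.
have k0 : 0 < k by rewrite divr_gt0.
have kE : k * (2 * e ^+ 2) = d by rewrite divfK// gt_eqF.
exists (1 - k) => [|x y exy xye]; first by lra.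
have gap : d <= resolvent_gap A x y.
  have Ax := resolventP maxA x; have Ay := resolventP maxA y.
  have [far|near] := leP (e / 2) `|resolvent A x - resolvent A y|.
    by apply: le_trans (gapA _ _ _ _ Ax Ay far); rewrite ge_min lexx.
  rewrite /resolvent_gap ipC; apply: le_trans (gapV _ _ _ _ Ax Ay _).
    by rewrite ge_min lexx orbT.
  set a := resolvent A x in near *; set b := resolvent A y in near *.
  have : `|x - y| <= `|a - b| + `|(x - a) - (y - b)|.
    have {1}-> : x - y = (a - b) + ((x - a) - (y - b)).
      by rewrite (opprD y) (addrACA x) -(opprD a) [RHS]addrC subrK.
    exact: ler_normD.
  by lra.
have := reflected_resolvent_sqr_dist A x y.
set s := `|x - y| in exy xye *; set t := `|_|.
set g := resolvent_gap A x y in gap * => tE.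
have s0 : 0 < s by exact: lt_le_trans exy.
have t0 : 0 <= t by exact: normr_ge0.
have ss : s ^+ 2 <= 4 * e ^+ 2.
  have -> : 4 * e ^+ 2 = (2 * e) ^+ 2 by ring.
  by rewrite lerXn2r ?nnegrE// ?ltW// mulr_gt0.
have kss : k * s ^+ 2 <= 2 * d.
  have := ler_wpM2l (ltW k0) ss; rewrite -kE; lra.
have tsk : t ^+ 2 <= s ^+ 2 * (1 - 2 * k) by rewrite tE; lra.
have k1 : 0 <= 1 - k.
  rewrite leNgt; apply/negP => k1.
  have : s ^+ 2 * (1 - 2 * k) < 0 by rewrite pmulr_rlt0 ?exprn_gt0//; lra.
  by have := sqr_ge0 t; lra.
rewrite -(@ler_pXn2r _ 2) ?nnegrE// ?(mulr_ge0 k1 (ltW s0))//.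
apply: le_trans tsk _.
have -> : ((1 - k) * s) ^+ 2 = s ^+ 2 * (1 - 2 * k) + (k * s) ^+ 2 by ring.
by rewrite lerDl sqr_ge0.
Qed.

Lemma zer_op_addP A B z : zer (op_add A B) z <-> exists2 u, A z u & B z (- u).
Proof.
split=> [[u Au [v Bv /eqP]]|[u Au Bu]].
  by rewrite addrC addr_eq0 => /eqP vE; exists u; rewrite -?vE.
by exists u => //; exists (- u); rewrite ?subrr.
Qed.

(** The elements of [A] and [B] certifying a zero are opposite, so for distinct zeros the two
    monotonicity inequalities add up to [d <= 0]. *)
Lemma zer_uniq {A B} : maximally_monotone ip A -> maximally_monotone ip B ->
  uniformly_monotone ip A ->
  forall z z', zer (op_add A B) z -> zer (op_add A B) z' -> z = z'.
Proof.
move=> maxA [monoB _] unifA z z' /zer_op_addP[u Au Bu] /zer_op_addP[u' Au' Bu'].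
apply/subr0_eq/eqP; rewrite -normr_le0 leNgt; apply/negP => zz'.
have [d d0 Hd] := uniformly_monotone_gap unifA _ zz'.
have := Hd _ _ _ _ Au Au' (lexx _); have := monoB _ _ _ _ Bu Bu'.
by rewrite /= !ipE; lra.
Qed.

(** * The operator [R_B R_A]: fixed points and nonexpansiveness *)

Section PeacemanRachford.
Context {A B : X -> set X}.
Hypotheses (maxA : maximally_monotone ip A) (maxB : maximally_monotone ip B).
Let T := reflected_resolvent B \o reflected_resolvent A.

Lemma peaceman_rachfordE x :
  T x = x + 2 *: (resolvent B (reflected_resolvent A x) - resolvent A x).
Proof. by rewrite /T /= {1}/reflected_resolvent opprB addrCA scalerBr. Qed.

Lemma Fix_resolvent_eq {x} : Fix T x ->
  resolvent B (reflected_resolvent A x) = resolvent A x.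
Proof.
rewrite /Fix /= peaceman_rachfordE -[X in _ = X]addr0 => /addrI/eqP.
by rewrite scaler_eq0 pnatr_eq0 /= => /eqP/subr0_eq.
Qed.

Lemma zer_resolvent_Fix {x} : Fix T x -> zer (op_add A B) (resolvent A x).
Proof.
move=> /Fix_resolvent_eq ba; apply/zer_op_addP; exists (x - resolvent A x).
  exact: resolventP.
have := resolventP maxB (reflected_resolvent A x); rewrite ba.
rewrite /reflected_resolvent; move: (resolvent A x) => a.
by rewrite scaler_nat mulr2n addrAC addrK opprB.
Qed.

(** For [u] in [A z] with [- u] in [B z], the point [z + u] is fixed: [R_A] sends it to [z - u], and
    both resolvents return [z]. *)
Lemma Fix_nonempty {z} : zer (op_add A B) z -> Fix T !=set0.
Proof.
move=> /zer_op_addP[u Au Bu]; exists (z + u).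
have JA : resolvent A (z + u) = z.
  by apply: resolvent_eq => //; rewrite addrC addKr.
have RA : reflected_resolvent A (z + u) = z - u.
  by rewrite /reflected_resolvent JA scaler_nat mulr2n opprD addrA addrK.
have JB : resolvent B (z - u) = z.
  by apply: resolvent_eq => //; rewrite addrC addKr.
by rewrite /Fix /= peaceman_rachfordE RA JB JA subrr scaler0 addr0.
Qed.

Lemma peaceman_rachford_nonexpansive : nonexpansive T.
Proof.
move=> x y; apply: le_trans (reflected_resolvent_nonexpansive maxA _ _).
exact: (reflected_resolvent_nonexpansive maxB).
Qed.

Lemma resolvent_gaps_cvg0 {I : Type} {F : set_system I} {FF : Filter F}
    {u v : I -> X} :
  (fun i => `|u i - v i| ^+ 2 - `|T (u i) - T (v i)| ^+ 2) @ F --> (0 : R) ->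
  (fun i => resolvent_gap A (u i) (v i)) @ F --> (0 : R) /\
  (fun i => resolvent_gap B (reflected_resolvent A (u i))
     (reflected_resolvent A (v i))) @ F --> (0 : R).
Proof.
have sum i : `|u i - v i| ^+ 2 - `|T (u i) - T (v i)| ^+ 2 =
    4 * resolvent_gap A (u i) (v i) + 4 * resolvent_gap B
      (reflected_resolvent A (u i)) (reflected_resolvent A (v i)).
  by rewrite /T /= !reflected_resolvent_sqr_dist; ring.
move=> sq0; split; apply: squeeze_cvgr (cvg_cst 0) sq0; apply: nearW => i;
  rewrite sum; have := resolvent_gap_ge0 maxA (u i) (v i);
  have := resolvent_gap_ge0 maxB (reflected_resolvent A (u i))
    (reflected_resolvent A (v i)); lra.
Qed.

Lemma peaceman_rachford_strongly_nonexpansive :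
  uniformly_monotone ip A -> uniformly_monotone ip B -> strongly_nonexpansive T.
Proof.
move=> unifA unifB; split; first exact: peaceman_rachford_nonexpansive.
move=> u v bnd norm0.
have [M uvM] : exists M, forall n, `|u n - v n| <= M.
  have [M [_ HM]] := bnd; exists (M + 1) => n.
  by apply: HM => //; rewrite ltrDl.
have /resolvent_gaps_cvg0[gapA gapB] :
    (fun n => `|u n - v n| ^+ 2 - `|T (u n) - T (v n)| ^+ 2) @ \oo --> (0 : R).
  (* A difference of squares is the difference of the norms times their sum, and that sum is at most
     [2 * M]. *)
  have M0 : (fun n => 2 * M * (`|u n - v n| - `|T (u n) - T (v n)|))
      @ \oo --> (0 : R).
    by rewrite -(mulr0 (2 * M)); exact: cvgMr.
  apply: squeeze_cvgr (cvg_cst 0) M0; apply: nearW => n.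
  have := peaceman_rachford_nonexpansive (u n) (v n); have := uvM n.
  move: `|u n - v n| `|_| (normr_ge0 (T (u n) - T (v n))) => s t t0 sM ts.
  rewrite subr_sqr mulrC; apply/andP; split.
    by rewrite mulr_ge0// ?subr_ge0//; lra.
  by apply: ler_wpM2r; rewrite ?subr_ge0//; lra.
rewrite (_ : (fun n => _) = fun n =>
  2 *: ((resolvent A (u n) - resolvent A (v n)) -
    (resolvent B (reflected_resolvent A (u n)) -
     resolvent B (reflected_resolvent A (v n))))).
  rewrite -(scaler0 X (2 : R)) -[in X in _ --> X](subrr 0).
  apply: cvgZ; first exact: cvg_cst.
  by apply: cvgB; [exact: resolvent_gap_cvg gapA|exact: resolvent_gap_cvg gapB].
apply/funext => n; rewrite !peaceman_rachfordE.
set a := resolvent A (u n); set a' := resolvent A (v n).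
set b := resolvent B _; set b' := resolvent B _.
have -> : u n + 2 *: (b - a) - (v n + 2 *: (b' - a')) =
    u n - v n + 2 *: ((b - a) - (b' - a')) by rewrite opprD addrACA -scalerBr.
rewrite opprD addrA subrr add0r -scalerN; congr (_ *: _).
by rewrite !opprB addrACA [RHS]addrACA [b' + a]addrC.
Qed.

(** * Orbits of [R_B R_A] relative to a fixed point *)

Section Iteration.
Context {x : nat -> X} {p : X}.
Hypotheses (xS : forall n, x n.+1 = T (x n)) (Tp : Fix T p).

Lemma iter_Fix_noninc : nonincreasing_seq (fun n => `|x n - p|).
Proof.
apply/nonincreasing_seqP => n.
by rewrite xS -{1}[p]Tp; exact: peaceman_rachford_nonexpansive.
Qed.

Lemma iter_Fix_is_cvg : cvgn (fun n => `|x n - p|).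
Proof.
apply: (nonincreasing_is_cvgn iter_Fix_noninc).
by exists 0 => _ [n _ <-]; exact: normr_ge0.
Qed.

Lemma iter_resolvent_cvg : uniformly_monotone ip A ->
  (fun n => resolvent A (x n)) @ \oo --> resolvent A p.
Proof.
move=> unifA; have /cvg_ex[l dl] := iter_Fix_is_cvg.
have sq : (fun n => `|x n - p| ^+ 2) @ \oo --> l ^+ 2.
  by rewrite expr2; under eq_fun do rewrite expr2; exact: cvgM.
have sqS : (fun n => `|x n.+1 - p| ^+ 2) @ \oo --> l ^+ 2.
  by rewrite (cvg_shiftS (fun n => `|x n - p| ^+ 2)).
(* Against the constant sequence [p], the loss of squared distance is a difference of consecutive
   terms of a convergent sequence. *)
have /(@resolvent_gaps_cvg0 _ _ _ x (fun=> p))[gap _] :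
    (fun n => `|x n - p| ^+ 2 - `|T (x n) - T p| ^+ 2) @ \oo --> (0 : R).
  rewrite -(subrr (l ^+ 2)) Tp; under [X in X @ _ --> _]eq_fun do rewrite -xS.
  exact: cvgB.
have /cvgrPdist_le a0 :
    (fun n => resolvent A (x n) - resolvent A p) @ \oo --> (0 : X).
  exact: resolvent_gap_cvg gap.
apply/cvgrPdist_le => e /a0; apply: filterS => n.
by rewrite sub0r normrN distrC.
Qed.

Lemma iter_asymptotically_regular : strongly_nonexpansive T ->
  (fun n => x n - T (x n)) @ \oo --> (0 : X).
Proof.
move=> [_ snT]; have /cvg_ex[l dl] := iter_Fix_is_cvg.
have dS : (fun n => `|x n.+1 - p|) @ \oo --> l.
  by rewrite (cvg_shiftS (fun n => `|x n - p|)).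
have := snT x (fun=> p); rewrite Tp.
under [X in _ -> _ -> X @ _ --> _]eq_fun do rewrite opprB addrA subrK.
apply.
  exists `|x 0%N - p|; split; first exact: num_real.
  by move=> M M0 n _ /=; apply: le_trans (ltW M0); exact: iter_Fix_noninc.
rewrite -(subrr l); under [X in X @ _ --> _]eq_fun do rewrite -xS.
exact: cvgB.
Qed.

End Iteration.

Lemma peaceman_rachford_contraction : uniformly_monotone ip A ->
  uniformly_monotone ip (op_inv A) -> contraction_for_large_distances T.
Proof.
move=> unifA unifV.
have := contraction_of_local (reflected_resolvent_nonexpansive maxA)
  (reflected_resolvent_local_contraction maxA unifA unifV).
move=> cA e /cA[K K1 TK]; exists K => // x y /TK; apply: le_trans.
exact: reflected_resolvent_nonexpansive maxB _ _.
Qed.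

End PeacemanRachford.

End MonotoneOperators.

Theorem theorem8p1 (R : realType) (X : completeNormedModType R)
    (ip : {dot X for @idfun R}) (hilbertX : induces_norm ip)
    (A B : X -> set X)
    (maxA : maximally_monotone ip A) (maxB : maximally_monotone ip B)
    (unifA : uniformly_monotone ip A)
    (T : X -> X)
    (defT : T = reflected_resolvent B \o reflected_resolvent A)
    (x y : nat -> X)
    (defx : forall n : nat, x n.+1 = T (x n))
    (defy : forall n : nat, y n = resolvent A (x n)) :
  (zer (op_add A B) !=set0 ->
    [/\ (exists z : X, zer (op_add A B) = [set z]) /\ Fix T !=set0,
        exists xbar : X,
          [/\ Fix T xbar, y @ \oo --> resolvent A xbar
            & zer (op_add A B) = [set resolvent A xbar]]
      & uniformly_monotone ip B ->
        strongly_nonexpansive T /\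
        exists xbar : X,
          [/\ Fix T xbar, y @ \oo --> resolvent A xbar,
              zer (op_add A B) = [set resolvent A xbar]
            & weakly_converges ip x xbar]]) /\
  (uniformly_monotone ip (op_inv A) ->
    contraction_for_large_distances T /\
    exists xbar : X, Fix T = [set xbar] /\ x @ \oo --> xbar).
Proof.
move: x y defx defy; rewrite {T}defT => x y xS yE.
have yJ : y = fun n => resolvent A (x n) by exact/funext.
split=> [[z zAB]|unifV].
  (* Proved for every fixed point, so that it applies both to the first one found and to the weak
     limit [c], which may differ from it. *)
  have zerE p : Fix (reflected_resolvent B \o reflected_resolvent A) p ->
      y @ \oo --> resolvent A p /\ zer (op_add A B) = [set resolvent A p].
    move=> Tp; rewrite yJ; split.
      exact: (iter_resolvent_cvg hilbertX maxA maxB xS Tp unifA).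
    have zp := zer_resolvent_Fix hilbertX maxA maxB Tp.
    apply/seteqP; split=> [z' z'AB|_ -> //].
    exact: (zer_uniq maxA maxB unifA _ _ z'AB zp).
  have [p Tp] := Fix_nonempty hilbertX maxA maxB zAB.
  have [yp zp] := zerE _ Tp.
  split.
  - by split; [exists (resolvent A p)|exists p].
  - by exists p.
  - move=> unifB.
    have snT := peaceman_rachford_strongly_nonexpansive
      hilbertX maxA maxB unifA unifB.
    split=> //.
    have [c Tc xc] : exists2 c,
        Fix (reflected_resolvent B \o reflected_resolvent A) c &
        weakly_converges ip x c.
      apply: (fejer_weak_cvg hilbertX (proj1 snT)); first by exists p.
        by move=> q Tq; exact: (iter_Fix_noninc hilbertX maxA maxB xS Tq).
      exact: (iter_asymptotically_regular hilbertX maxA maxB xS Tp snT).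
    by have [yc zc] := zerE _ Tc; exists c.
have cT := peaceman_rachford_contraction hilbertX maxA maxB unifA unifV.
split=> //; apply: rakotch cT xS.
exact: (peaceman_rachford_nonexpansive hilbertX maxA maxB).
Qed.
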